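(* Let $\gamma: I\to\mathbb{E}^n$ be a curve in the $n$-dimensional Euclidean space, parametrized by its arclength, with Frenet curvatures $k_1,k_2,k_3,\dots$, and let $f:I\to(0,\infty)$ be a smooth function. Then $\gamma$ is a bi-$f$-harmonic curve if and only if $$\left\{\begin{array}{l} -3k_1k_1'f^2-4k_1^2ff'+ff'''+f'f''=0,\\ -k_1^3f^2-k_1k_2^2f^2+k_1''f^2+4k_1'ff'+3k_1ff''+2k_1(f')^2=0,\\ 2k_1'k_2f+k_1k_2'f+4k_1k_2f'=0,\\ k_1k_2k_3=0. \end{array}\right.$$
   Context: $I\subset\mathbb{R}$ is an open interval, and $\gamma:I\to (N,h)$ is a smooth curve parametrized by arclength in an $n$-dimensional Riemannian manifold (here $N=\mathbb{E}^n$), with unit tangent $T=\gamma'$; $\nabla^N$ is the Levi-Civita connection and $R^N(X,Y)=[\nabla_X,\nabla_Y]-\nabla_{[X,Y]}$ is the curvature operator. For a smooth function $f:I\to(0,\infty)$, the $f$-tension field of $\gamma$ is $\tau_f(\gamma)=f\,\nabla^N_TT+f'T$. The curve $\gamma$ is called bi-$f$-harmonic if it is a critical point of the bi-$f$-energy $\frac12\int|\tau_f(\gamma)|^2\,dt$ (over compact subdomains), i.e. if it satisfies the Euler-Lagrange equation $\nabla^N_T\big(f\,\nabla^N_T\tau_f(\gamma)\big)+f\,R^N(\tau_f(\gamma),T)T=0$. Frenet frame: $\{E_1,\dots,E_n\}$ is an orthonormal frame along $\gamma$ with $E_1=T$ satisfying $\nabla^N_TE_1=k_1E_2$, $\nabla^N_TE_r=-k_{r-1}E_{r-1}+k_rE_{r+1}$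 for $2\le r\le n-1$, $\nabla^N_TE_n=-k_{n-1}E_{n-1}$, where $k_1=\|\nabla^N_TE_1\|$ and $k_2,\dots,k_{n-1}$ are non-negative (smooth) real functions on $I$, the curvatures of $\gamma$; curvatures $k_r$ with $r\ge n$ are read as $0$. Primes denote derivatives with respect to the arclength parameter. *)

(* Defs.v *)
From HB Require Import structures.
From mathcomp Require Import all_boot all_order all_algebra.
From mathcomp Require Import all_classical all_reals all_analysis.

Set Implicit Arguments.
Unset Strict Implicit.
Unset Printing Implicit Defensive.

Import Order.TTheory GRing.Theory Num.Theory.
Import numFieldNormedType.Exports.

Local Open Scope classical_set_scope.
Local Open Scope ring_scope.

(* The library norm on 'rV[R]_n is the sup norm; it is used only for the
   topology and for derivatives. The Euclidean metric is given by edot. *)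
Definition edot (R : realType) (n : nat) (u v : 'rV[R]_n) : R :=
  \sum_(i < n) u 0 i * v 0 i.

Definition enorm (R : realType) (n : nat) (u : 'rV[R]_n) : R :=
  Num.sqrt (edot u u).

(* C^oo on a set I meant to be open: functions on I are represented by total
   functions, whose values outside I are irrelevant. *)
Definition smooth_on (R : realType) (V : normedModType R) (I : set R)
    (g : R -> V) : Prop :=
  forall (m : nat) (t : R), I t -> derivable (derive1n m g) t 1.

(* Levi-Civita connection of Euclidean space: (nabla_X Y)(p) is the directional
   derivative of Y at p along X p. *)
Definition nabla (R : realType) (n : nat) (X Y : 'rV[R]_n -> 'rV[R]_n) :
    'rV[R]_n -> 'rV[R]_n :=
  fun p => 'D_(X p) Y p.

Definition lie_bracket (R : realType) (n : nat) (X Y : 'rV[R]_n -> 'rV[R]_n) :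
    'rV[R]_n -> 'rV[R]_n :=
  fun p => nabla X Y p - nabla Y X p.

Definition curvature_op (R : realType) (n : nat)
    (X Y Z : 'rV[R]_n -> 'rV[R]_n) : 'rV[R]_n -> 'rV[R]_n :=
  fun p => nabla X (nabla Y Z) p - nabla Y (nabla X Z) p
           - nabla (lie_bracket X Y) Z p.

(* The curvature operator is tensorial, so its value on tangent vectors u, v, w
   at p may be computed on any extensions; we take the constant ones. *)
Definition curvature_at (R : realType) (n : nat) (p u v w : 'rV[R]_n) :
    'rV[R]_n :=
  curvature_op (cst u) (cst v) (cst w) p.

(* Covariant derivative nabla_T of a vector field along a curve; in the global
   parallel frame of Euclidean space it is the ordinary derivative. *)
Definition nablaT (R : realType) (n : nat) (X : R -> 'rV[R]_n) :
    R -> 'rV[R]_n :=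
  derive1 X.

Definition f_tension (R : realType) (n : nat) (f : R -> R)
    (gamma : R -> 'rV[R]_n) : R -> 'rV[R]_n :=
  fun t => f t *: nablaT (derive1 gamma) t + derive1 f t *: derive1 gamma t.

(* Euler-Lagrange equation of the bi-f-energy. *)
Definition bi_f_harmonic (R : realType) (n : nat) (I : set R) (f : R -> R)
    (gamma : R -> 'rV[R]_n) : Prop :=
  forall t, I t ->
    nablaT (fun s => f s *: nablaT (f_tension f gamma) s) t
    + f t *: curvature_at (gamma t) (f_tension f gamma t)
                          (derive1 gamma t) (derive1 gamma t) = 0.

(* E r and k r are indexed from 1 as usual; E r is constrained only for
   1 <= r <= n, and k r with r >= n is read as 0 (so for n = 1 the first Frenet
   equation says that E 1 is parallel). *)
Record frenet_frame (R : realType) (n : nat) (I : set R)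
    (gamma : R -> 'rV[R]_n) (E : nat -> R -> 'rV[R]_n) (k : nat -> R -> R) :
    Prop := FrenetFrame {
  frame_smooth : forall r, (1 <= r <= n)%N -> smooth_on I (E r) ;
  frame_orthonormal : forall r s t, (1 <= r <= n)%N -> (1 <= s <= n)%N ->
    I t -> edot (E r t) (E s t) = (r == s)%:R ;
  frame_tangent : forall t, I t -> E 1%N t = derive1 gamma t ;
  curvature_smooth : forall r, (1 <= r < n)%N -> smooth_on I (k r) ;
  curvature_ge0 : forall r t, (1 <= r < n)%N -> I t -> 0 <= k r t ;
  curvature_out : forall r t, (n <= r)%N -> I t -> k r t = 0 ;
  curvature1E : forall t, I t -> k 1%N t = enorm (nablaT (E 1%N) t) ;
  frenet_first : forall t, I t ->
    nablaT (E 1%N) t = k 1%N t *: E 2%N t ;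
  frenet_middle : forall r t, (2 <= r < n)%N -> I t ->
    nablaT (E r) t = - k r.-1 t *: E r.-1 t + k r t *: E r.+1 t ;
  frenet_last : forall t, (2 <= n)%N -> I t ->
    nablaT (E n) t = - k n.-1 t *: E n.-1 t
}.

(* Main.v *)
Require Import Defs.
From HB Require Import structures.
From mathcomp Require Import all_boot all_order all_algebra.
From mathcomp Require Import all_classical all_reals all_analysis.
From mathcomp Require Import ring zify.

Import Order.TTheory GRing.Theory Num.Theory.
Import numFieldNormedType.Exports.

Local Open Scope classical_set_scope.
Local Open Scope ring_scope.

(** Euclidean space is flat, so the curvature term of the Euler-Lagrange
    equation vanishes ([curvature_at_eq0]) and the equation reduces to
    [(f * tau')' = 0], where [tau = f' E_1 + f k_1 E_2] is the [f]-tension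
    field. Differentiating a combination of [E_1, E_2, E_3] with the Frenet
    equations gives a combination of [E_1, ..., E_4]
    ([extend_frame_comb_derive]); doing this twice yields
      [f tau' = f (f'' - f k_1^2) E_1 + f (2 f' k_1 + f k_1') E_2
                + f^2 k_1 k_2 E_3]
    and then [(f tau')' = c_1 E_1 + c_2 E_2 + f c_3 E_3 + f^2 c_4 E_4], where
    [c_1, ..., c_4] are the left-hand sides of the four equations of the
    system. As the frame is orthonormal and [f > 0], the sum vanishes exactly
    when all the [c_i] do ([extend_frame_comb_eq0]).

    In dimension below 4 not all of [E_1, ..., E_4] exist. Replacing the
    missing vectors by the zero field keeps the Frenet equations true, in one
    single form for all indices ([extend_frame_derive]), because the
    corresponding curvatures are 0. For the same reason the coefficients
    standing in front of the missing vectors vanish, so that comparing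
    coefficients remains legitimate: as [I] is open, a curvature that is 0 on
    [I] has all its derivatives 0 on [I]. *)

Set Implicit Arguments.
Unset Strict Implicit.

(** * Derivatives of matrix-valued functions *)

Lemma is_derive_mx (R : realFieldType) (V : normedModType R) (m n : nat)
    (M : V -> 'M[R]_(m, n)) (dM : 'M[R]_(m, n)) (t v : V) :
  (forall i j, is_derive t v (fun x => M x i j) (dM i j)) ->
  is_derive t v M dM.
Proof.
move=> dMij; have Mt : derivable M t v.
  by apply/derivable_mxP => i j; case: (dMij i j).
apply: DeriveDef => //; rewrite derive_mx //.
by apply/matrixP => i j; rewrite mxE; case: (dMij i j).
Qed.

Lemma is_derive_mxcoef (R : realFieldType) (V : normedModType R) (m n : nat)
    (M : V -> 'M[R]_(m, n)) (dM : 'M[R]_(m, n)) (t v : V) i j :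
  is_derive t v M dM -> is_derive t v (fun x => M x i j) (dM i j).
Proof.
move=> [Mt <-]; rewrite derive_mx // mxE.
by apply: derivableP; move/derivable_mxP : Mt.
Qed.

Lemma is_derive_scale_mx (R : realFieldType) (V : normedModType R) (m n : nat)
    (a : V -> R) (da : R) (M : V -> 'M[R]_(m, n)) (dM : 'M[R]_(m, n))
    (t v : V) :
  is_derive t v a da -> is_derive t v M dM ->
  is_derive t v (fun x => a x *: M x) (da *: M t + a t *: dM).
Proof.
move=> da_t dM_t; apply: is_derive_mx => i j.
have -> : (fun x => (a x *: M x) i j) = a * (fun x => M x i j).
  by apply/funext => x; rewrite mxE.
apply: (is_derive_eq (is_deriveM da_t (is_derive_mxcoef i j dM_t))).
by rewrite !mxE addrC; congr (_ + _); rewrite mulrC.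
Qed.

(** [is_deriveM] yields pointwise products of functions and scalings of the
    field acting on itself; in this form the rule can be iterated and the
    result passed to [ring]. *)
Lemma is_derive_mul (R : realType) (a b : R -> R) (da db t : R) :
  is_derive t 1 a da -> is_derive t 1 b db ->
  is_derive t 1 (fun s => a s * b s) (da * b t + a t * db).
Proof.
move=> da_t db_t; apply: (is_derive_eq (is_deriveM da_t db_t)).
by rewrite addrC [da * _]mulrC.
Qed.

(** * Derivatives on an open set *)

Lemma derive1n_eq_on (R : realType) (V : normedModType R) (I : set R)
    (g h : R -> V) :
  open I -> (forall t, I t -> g t = h t) ->
  forall m t, I t -> derive1n m g t = derive1n m h t.
Proof.
move=> Io gh; elim=> [|m IHm] t It; first exact: gh.
rewrite !derive1nS !derive1E; apply: near_eq_derive.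
by apply: filterS (open_nbhs_nbhs (conj Io It)) => s /IHm.
Qed.

Lemma derive1_eq_on (R : realType) (V : normedModType R) (I : set R)
    (g h : R -> V) (t : R) (dh : V) :
  open I -> (forall s, I s -> g s = h s) -> I t ->
  is_derive t 1 h dh -> derive1 g t = dh.
Proof.
move=> Io gh It [_ <-].
by have /= := derive1n_eq_on Io gh 1 It; rewrite !derive1E.
Qed.

Lemma derive1n_cst0 (R : realType) (V : normedModType R) (m : nat) :
  derive1n m (cst 0 : R -> V) = cst 0.
Proof.
elim: m => [//|m IHm]; rewrite derive1nS IHm.
by apply/funext => t; rewrite derive1_cst.
Qed.

Lemma smooth_on_eq0 (R : realType) (V : normedModType R) (I : set R)
    (g : R -> V) :
  open I -> (forall t, I t -> g t = 0) -> smooth_on I g.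
Proof.
move=> Io g0 m t It.
have d0 : derivable (cst 0 : R -> V) t 1 by exact: derivable_cst.
apply: near_eq_derivable d0.
apply: filterS (open_nbhs_nbhs (conj Io It)) => s Is.
by rewrite (@derive1n_eq_on _ _ _ _ (cst 0) Io g0) // derive1n_cst0.
Qed.

Lemma smooth_on_is_derive (R : realType) (V : normedModType R) (I : set R)
    (g : R -> V) (m : nat) (t : R) :
  smooth_on I g -> I t -> is_derive t 1 (derive1n m g) (derive1n m.+1 g t).
Proof.
by move=> gI It; rewrite derive1nS derive1E; apply: derivableP; exact: gI.
Qed.

(** * Euclidean geometry *)

Lemma curvature_at_eq0 (R : realType) (n : nat) (p u v w : 'rV[R]_n) :
  curvature_at p u v w = 0.
Proof.
have nabla_cst (X : 'rV[R]_n -> 'rV[R]_n) (y : 'rV[R]_n) :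
    nabla X (cst y) = cst 0.
  by apply/funext => q; rewrite /nabla derive_cst.
by rewrite /curvature_at /curvature_op !nabla_cst /= !subr0.
Qed.

Lemma edot_suml (R : realType) (n m : nat) (c : 'I_m -> R)
    (u : 'I_m -> 'rV[R]_n) (v : 'rV[R]_n) :
  edot (\sum_i c i *: u i) v = \sum_i c i * edot (u i) v.
Proof.
rewrite /edot; under [RHS]eq_bigr do rewrite mulr_sumr.
rewrite exchange_big /=; apply: eq_bigr => j _.
rewrite summxE mulr_suml; apply: eq_bigr => i _.
by rewrite mxE mulrA.
Qed.

Lemma edot0l (R : realType) (n : nat) (v : 'rV[R]_n) : edot 0 v = 0.
Proof. by rewrite /edot big1 // => i _; rewrite mxE mul0r. Qed.

(** * Frenet frames *)

(** With the zero field at the indices 0 and [r > n], the three shapes of the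
    Frenet equations (first, middle, last) become the same one. *)
Definition extend_frame (R : realType) (n : nat) (E : nat -> R -> 'rV[R]_n)
    (r : nat) : R -> 'rV[R]_n :=
  if (1 <= r <= n)%N then E r else cst 0.

Section Frenet.
Context (R : realType) (n : nat) (I : set R) (gamma : R -> 'rV[R]_n)
  (E : nat -> R -> 'rV[R]_n) (k : nat -> R -> R)
  (frenet : frenet_frame I gamma E k).

Local Notation F := (extend_frame E).

Lemma frenet_curvature_smooth (r : nat) :
  open I -> (1 <= r)%N -> smooth_on I (k r).
Proof.
move=> Io r1; case: (ltnP r n) => [rn|nr].
  by apply: (curvature_smooth frenet); rewrite r1.
by apply: smooth_on_eq0 => // t; exact: (curvature_out frenet).
Qed.

Lemma frenet_curvature_derive_eq0 (r m : nat) (t : R) :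
  open I -> (n <= r)%N -> I t -> derive1n m (k r) t = 0.
Proof.
move=> Io nr It.
rewrite (@derive1n_eq_on _ _ _ _ (cst 0) Io) ?derive1n_cst0 //.
by move=> s; exact: (curvature_out frenet).
Qed.

(** The Frenet equations for the extended frame. The terms that are absent from
    the original equations are those whose vector has been set to 0; when the
    differentiated vector itself has been set to 0, the right-hand side
    vanishes because [k r = 0] for [r >= n]. *)
Lemma extend_frame_derive (r : nat) (t : R) : I t ->
  is_derive t 1 (F r.+1) (- k r t *: F r t + k r.+1 t *: F r.+2 t).
Proof.
move=> It; rewrite /extend_frame.
case: (leqP r.+1 n) => rn /=; last first.
  rewrite (curvature_out frenet (r:=r)) // oppr0 scale0r add0r.
  by rewrite ifF ?scaler0; [exact: is_derive_cst|lia].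
have dE : derivable (E r.+1) t 1.
  exact: (frame_smooth frenet (r:=r.+1) rn (m:=0%N) It).
apply: DeriveDef => //; rewrite -derive1E.
case: r rn dE => [|r] rn dE /=.
  rewrite scaler0 add0r [LHS](frenet_first frenet) //.
  (* For n = 1 the vector E 2 is unconstrained, but it comes with k 1 = 0. *)
  case: ltnP => // n1.
  by rewrite (curvature_out frenet (r:=1%N)) // !scale0r.
rewrite ifT; last by lia.
case: (ltnP r.+2 n) => n1.
  by rewrite [LHS](frenet_middle frenet).
have last_eq q : q = n -> nablaT (E q) t = - k q.-1 t *: E q.-1 t.
  by move=> ->; apply: (frenet_last frenet) => //; lia.
by rewrite [LHS](last_eq r.+2) ?scaler0 ?addr0 //; lia.
Qed.

(** Coefficients are recovered by taking the scalar product with each vector of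
    the frame; this says nothing about the coefficients of the vectors that
    were set to 0, whence the hypothesis on them. *)
Lemma extend_frame_comb_eq0 (m : nat) (c : nat -> R) (t : R) : I t ->
  (forall r, (n <= r)%N -> c r = 0) ->
  \sum_(i < m) c i *: F i.+1 t = 0 <-> forall i, (i < m)%N -> c i = 0.
Proof.
move=> It cn; split=> [c0 i im|c0]; last first.
  by rewrite big1 // => i _; rewrite c0 // scale0r.
case: (leqP n i) => [/cn //|ni].
have := edot_suml (fun i : 'I_m => c i) (fun i => F i.+1 t) (E i.+1 t).
rewrite c0 edot0l (bigD1 (Ordinal im)) //= big1 ?addr0 => [|j ji].
  by rewrite /extend_frame ni (frame_orthonormal frenet) // eqxx mulr1 => <-.
rewrite /extend_frame; case: (leqP j.+1 n) => jn /=; last first.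
  by rewrite edot0l mulr0.
rewrite (frame_orthonormal frenet) // eqSS.
by rewrite -val_eqE /= in ji; rewrite (negbTE ji) mulr0.
Qed.

Lemma extend_frame_comb_derive (a b c : R -> R) (da db dc t : R) : I t ->
  is_derive t 1 a da -> is_derive t 1 b db -> is_derive t 1 c dc ->
  is_derive t 1 (fun s => a s *: F 1 s + b s *: F 2 s + c s *: F 3 s)
    ((da - b t * k 1 t) *: F 1 t + (db + a t * k 1 t - c t * k 2 t) *: F 2 t
      + (dc + b t * k 2 t) *: F 3 t + (c t * k 3 t) *: F 4 t).
Proof.
move=> It da_t db_t dc_t.
have dF r := extend_frame_derive r It.
apply: (is_derive_eq (is_deriveD (is_deriveD
  (is_derive_scale_mx da_t (dF 0%N))
  (is_derive_scale_mx db_t (dF 1%N)))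
  (is_derive_scale_mx dc_t (dF 2%N)))).
have -> : F 0 t = 0 by [].
by apply/rowP => i; rewrite !mxE; ring.
Qed.

End Frenet.

(** * The system of equations *)

Unset Implicit Arguments.

Theorem theorem3p7 (R : realType) (n : nat) (I : set R)
    (gamma : R -> 'rV[R]_n) (E : nat -> R -> 'rV[R]_n) (k : nat -> R -> R)
    (f : R -> R)
    (I_open : open I) (I_itv : is_interval I)
    (gamma_smooth : smooth_on I gamma)
    (gamma_arclength : forall t, I t -> enorm (derive1 gamma t) = 1)
    (gamma_frenet : frenet_frame I gamma E k)
    (f_smooth : smooth_on I f) (f_gt0 : forall t, I t -> 0 < f t) :
  let k1 := k 1%N in let k2 := k 2%N in let k3 := k 3%N in
  bi_f_harmonic I f gamma <->
  (forall t, I t ->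
    [/\ - 3 * k1 t * derive1 k1 t * f t ^+ 2 - 4 * k1 t ^+ 2 * f t * derive1 f t
          + f t * derive1n 3 f t + derive1 f t * derive1n 2 f t = 0,
        - k1 t ^+ 3 * f t ^+ 2 - k1 t * k2 t ^+ 2 * f t ^+ 2
          + derive1n 2 k1 t * f t ^+ 2 + 4 * derive1 k1 t * f t * derive1 f t
          + 3 * k1 t * f t * derive1n 2 f t + 2 * k1 t * derive1 f t ^+ 2 = 0,
        2 * derive1 k1 t * k2 t * f t + k1 t * derive1 k2 t * f t
          + 4 * k1 t * k2 t * derive1 f t = 0 &
        k1 t * k2 t * k3 t = 0]).
Proof.
move=> k1 k2 k3.
have n_gt0 t : I t -> (0 < n)%N.
  move=> It; have [n0|//] := posnP n.
  have /eqP := gamma_arclength t It; rewrite /enorm /edot big1 => [|i _].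
    by rewrite sqrtr0 eq_sym oner_eq0.
  by have := ltn_ord i; rewrite [in X in (_ < X)%N]n0.
set F := extend_frame E.
have f_derivatives t : I t -> [/\ is_derive t 1 f (derive1 f t),
    is_derive t 1 (derive1 f) (derive1n 2 f t) &
    is_derive t 1 (derive1n 2 f) (derive1n 3 f t)].
  move=> It; have df m := smooth_on_is_derive m f_smooth It.
  by split; [exact: (df 0%N)|exact: (df 1%N)|exact: (df 2%N)].
have k_derivatives t : I t -> [/\ is_derive t 1 k1 (derive1 k1 t),
    is_derive t 1 (derive1 k1) (derive1n 2 k1 t) &
    is_derive t 1 k2 (derive1 k2 t)].
  move=> It; have dk r m (r1 : (1 <= r)%N) := smooth_on_is_derive m
    (frenet_curvature_smooth gamma_frenet I_open r1) It.
  by split; [exact: (dk 1%N 0%N)|exact: (dk 1%N 1%N)|exact: (dk 2%N 0%N)].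
have tensionE t : I t -> f_tension f gamma t
    = derive1 f t *: F 1 t + (f t * k1 t) *: F 2 t + 0 *: F 3 t.
  move=> It; rewrite scale0r addr0 addrC /f_tension.
  have tangentE s : I s -> derive1 gamma s = F 1 s.
    move=> Is; rewrite -(frame_tangent gamma_frenet Is) /F /extend_frame.
    by rewrite (n_gt0 s Is).
  congr (_ + _); last by rewrite tangentE.
  rewrite -scalerA; congr (_ *: _).
  apply: (derive1_eq_on I_open tangentE It).
  apply: (is_derive_eq (extend_frame_derive gamma_frenet 0 It)).
  by rewrite scaler0 add0r.
have dtensionE t : I t -> f t *: nablaT (f_tension f gamma) t
    = (f t * (derive1n 2 f t - f t * k1 t * k1 t)) *: F 1 t
      + (f t * (2 * derive1 f t * k1 t + f t * derive1 k1 t)) *: F 2 t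
      + (f t * (f t * k1 t * k2 t)) *: F 3 t.
  move=> It; rewrite /nablaT.
  have [df df' _] := f_derivatives t It; have [dk1 _ _] := k_derivatives t It.
  have dT := extend_frame_comb_derive gamma_frenet It df'
    (is_derive_mul df dk1) (is_derive_cst (0 : R) t 1).
  rewrite (derive1_eq_on I_open tensionE It dT).
  by rewrite /cst -/F -/k1 -/k2 -/k3; apply/rowP => i; rewrite !mxE; ring.
pose c1 t := - 3 * k1 t * derive1 k1 t * f t ^+ 2
  - 4 * k1 t ^+ 2 * f t * derive1 f t
  + f t * derive1n 3 f t + derive1 f t * derive1n 2 f t.
pose c2 t := - k1 t ^+ 3 * f t ^+ 2 - k1 t * k2 t ^+ 2 * f t ^+ 2
  + derive1n 2 k1 t * f t ^+ 2 + 4 * derive1 k1 t * f t * derive1 f t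
  + 3 * k1 t * f t * derive1n 2 f t + 2 * k1 t * derive1 f t ^+ 2.
pose c3 t := 2 * derive1 k1 t * k2 t * f t + k1 t * derive1 k2 t * f t
  + 4 * k1 t * k2 t * derive1 f t.
pose c4 t := k1 t * k2 t * k3 t.
(* Numbered from 0: coef t i goes with the vector F i.+1. *)
pose coef t := nth 0 [:: c1 t; c2 t; f t * c3 t; f t ^+ 2 * c4 t].
have euler_lagrangeE t : I t ->
    nablaT (fun s => f s *: nablaT (f_tension f gamma) s) t
    = \sum_(i < 4) coef t i *: F i.+1 t.
  move=> It; have [df df' df''] := f_derivatives t It.
  have [dk1 dk1' dk2] := k_derivatives t It.
  have da := is_derive_mul df
    (is_deriveB df'' (is_derive_mul (is_derive_mul df dk1) dk1)).
  have db := is_derive_mul df (is_deriveD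
    (is_derive_mul (is_derive_mul (is_derive_cst (2 : R) t 1) df') dk1)
    (is_derive_mul df dk1')).
  have dc := is_derive_mul df (is_derive_mul (is_derive_mul df dk1) dk2).
  have dW := extend_frame_comb_derive gamma_frenet It da db dc.
  rewrite /nablaT (derive1_eq_on I_open dtensionE It dW).
  rewrite !big_ord_recr big_ord0 /= add0r -/F /coef /=.
  (* Iterated derivatives are replaced by variables because ring is slow at
     comparing them up to conversion. *)
  congr (_ *: _ + _ *: _ + _ *: _ + _ *: _);
    rewrite /c1 /c2 /c3 /c4 /k1 /k2 /k3 ?fctE /=;
    move: (f t) (derive1 f t) (derive1 (derive1 f) t)
      (derive1 (derive1 (derive1 f)) t) (k 1%N t) (derive1 (k 1%N) t)
      (derive1 (derive1 (k 1%N)) t) (k 2%N t) (derive1 (k 2%N) t) (k 3%N t)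
      => *; ring.
(* For r > 0 every term of the coefficient contains k r or one of its
   derivatives; r = 0 is excluded since n > 0. *)
have coef_out t r : I t -> (n <= r)%N -> coef t r = 0.
  move=> It.
  have k0 q (nq : (n <= q)%N) m : derive1n m (k q) t = 0.
    exact: (frenet_curvature_derive_eq0 gamma_frenet m I_open nq It).
  rewrite /coef; case: r => [|[|[|[|r]]]] nr /=; last by rewrite nth_nil.
  - by have := n_gt0 t It; lia.
  - have /= := (k0 _ nr 0%N, k0 _ nr 1%N, k0 _ nr 2%N).
    rewrite -/k1 => -[[k1t k1't] k1''t].
    by rewrite /c2 k1t k1't /= k1''t; ring.
  - have /= := (k0 _ nr 0%N, k0 _ nr 1%N); rewrite -/k2 => -[k2t k2't].
    by rewrite /c3 k2t k2't; ring.
  - by have /= k3t := k0 _ nr 0%N; rewrite /c4 /k3 k3t !mulr0.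
have harmonicE t : I t ->
    nablaT (fun s => f s *: nablaT (f_tension f gamma) s) t
      + f t *: curvature_at (gamma t) (f_tension f gamma t)
                            (derive1 gamma t) (derive1 gamma t) = 0
    <-> forall i, (i < 4)%N -> coef t i = 0.
  move=> It; rewrite euler_lagrangeE // curvature_at_eq0 scaler0 addr0.
  by apply: (extend_frame_comb_eq0 gamma_frenet) => // r; exact: coef_out.
split=> [H t It|H t It].
  have /harmonicE -/(_ It) coef0 := H t It.
  have fn0 : f t != 0 by rewrite gt_eqF // f_gt0.
  split; [exact: (coef0 0%N)|exact: (coef0 1%N)| |].
  - have /eqP := coef0 2%N isT.
    by rewrite mulf_eq0 (negbTE fn0) => /eqP.
  - have /eqP := coef0 3%N isT.
    by rewrite mulf_eq0 expf_eq0 (negbTE fn0) => /eqP.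
have [eq1 eq2 eq3 eq4] := H t It.
apply/(harmonicE t It); case=> [|[|[|[|//]]]] _ //=; rewrite /coef /=.
  by rewrite /c3 eq3 mulr0.
by rewrite /c4 eq4 mulr0.
Qed.
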